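(* Let $b$ be a locally finite, connected graph over $(X,m)$, $q:X\to\mathbb{R}$, and let the associated form $h$ be bounded from below on $\ell^2(X,m)$. Let $\lambda\in\mathbb{R}$ and $a\in(0,1]$ be such that $h-\lambda\ge a\deg_m$ on $C_c(X\setminus K)$ for a finite set $K\subseteq X$. Let $u$ be either (a) an approximable function $u\in\mathcal{F}$ that satisfies $(\mathcal{H}-\lambda)u=0$ on $X\setminus K$, or that satisfies $u\ge0$ and $(\mathcal{H}-\lambda)u\le0$ on $X\setminus K$, or (b) a function $u\in D(H)$ with $(\mathcal{H}-\lambda)u=0$ on $X\setminus K$, where in this case $q\in V$ is assumed. Then there is $r=r(a)>0$ such that $$u\in\ell^2(X,e^{r|\cdot|}\deg),$$ where $|x|$ is the natural (combinatorial) graph distance of $x\in X$ to a fixed vertex $o\in X$. In particular, one can choose any $r>0$ such that $r^2\left(\frac{1+e^r}{16}\right)<a$, for example $r=2ae^{-a}$.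
   Context: $X$ is an infinite countable set, $m:X\to(0,\infty)$, and a graph $b$ over $(X,m)$ is a symmetric function $b:X\times X\to[0,\infty)$ with zero diagonal and $\sum_{y}b(x,y)<\infty$ for all $x$; $x\sim y$ means $b(x,y)>0$; the graph is locally finite if $\#\{y:y\sim x\}<\infty$ for all $x$. $C(X)$ is the space of real functions on $X$, $C_c(X)$ those with finite support, and for $W\subseteq X$, $C_c(W)$ consists of those $\varphi\in C_c(X)$ vanishing outside $W$. $q=q_+-q_-$ is the decomposition of $q$ into positive and negative parts, $\deg(x)=\sum_yb(x,y)+q_+(x)m(x)$ and $\deg_m(x)=\deg(x)/m(x)$. For $f\in C(X)$, $|\nabla f|^2(x)=\frac{1}{2m(x)}\sum_{y}b(x,y)(f(x)-f(y))^2$. $h(\varphi)=h_{b,q}(\varphi)=\sum_{X}(|\nabla\varphi|^2+q\varphi^2)m$ for $\varphi\in C_c(X)$. ''$h-\lambda\ge w$ on $C_c(W)$'' means $h(\varphi)-\lambda\sum_X\varphi^2m\ge\sum_X w\varphi^2m$ for all $\varphi\in C_c(W)$. $h$ bounded from below on $\ell^2(X,m)$ means $h(\varphi)\ge -C\sum_X\varphi^2m$ on $C_c(X)$ for some $C$; then $h$ is closable, its closure is again denoted $h$ with domain $D(h)$, and $H$ is the associated self-adjoint operator with domain $D(H)$. $H$ is a restriction of the formal operator $\mathcal{H}f(x)=\frac1{m(x)}\sum_y b(x,y)(f(x)-f(y))+q(x)f(x)$, defined on $\mathcal{F}=\{f\in C(X):\sum_y b(x,y)|f(y)|<\infty\ \forall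 x\in X\}$. $V$ is the set of $q\in C(X)$ such that for some $\varepsilon>0,C>0$: $\sum_X q_-\varphi^2m\le(1-\varepsilon)h_{b,q_+}(\varphi)+C\sum_X\varphi^2m$ for all $\varphi\in C_c(X)$. A function $u\in\mathcal{F}$ is approximable if there is a sequence $(\varphi_n)$ in $C_c(X)$ with $0\le\varphi_n\nearrow1$ pointwise and $\lim_{n\to\infty}\sum_Xu^2|\nabla\varphi_n|^2m=0$. For a weight $\mu\ge0$, $u\in\ell^2(X,\mu)$ means $\sum_Xu^2\mu<\infty$. *)

(* Defs.v *)
From HB Require Import structures.
From mathcomp Require Import all_boot all_order all_algebra.
From mathcomp Require Import all_classical all_reals all_analysis.
Set Implicit Arguments.
Unset Strict Implicit.
Unset Printing Implicit Defensive.
Import Order.TTheory GRing.Theory Num.Theory.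
Import numFieldNormedType.Exports.
Local Open Scope classical_set_scope.
Local Open Scope ring_scope.

(* Real-valued sum of an absolutely summable family. [esum] is a supremum of
   finite partial sums, hence the splitting into positive and negative parts.
   The value is meaningless when both parts have an infinite sum. *)
Definition rsum (R : realType) (X : choiceType) (f : X -> R) : R :=
  fine (\esum_(x in [set: X]) (f^\+ x)%:E) -
  fine (\esum_(x in [set: X]) (f^\- x)%:E).

Record is_graph (R : realType) (X : choiceType) (b : X -> X -> R) : Prop :=
  IsGraph {
    graph_ge0 : forall x y, 0 <= b x y;
    graph_sym : forall x y, b x y = b y x;
    graph_diag : forall x, b x x = 0;
    graph_sum : forall x, (\esum_(y in [set: X]) (b x y)%:E < +oo)%E }.

Definition adj (R : realType) (X : choiceType) (b : X -> X -> R) : rel X :=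
  fun x y => 0 < b x y.

Definition locally_finite_graph (R : realType) (X : choiceType)
    (b : X -> X -> R) : Prop :=
  forall x, finite_set [set y | adj b x y].

Definition connected_graph (R : realType) (X : choiceType)
    (b : X -> X -> R) : Prop :=
  forall x y, exists p : seq X, path (adj b) x p /\ last x p = y.

(* [path e x p] is about the vertices x :: p, so it has [size p] edges.
   The set below is non-empty for connected graphs. *)
Definition dist (R : realType) (X : choiceType) (b : X -> X -> R)
    (x y : X) : R :=
  inf [set (size p)%:R | p in [set p : seq X | path (adj b) x p /\ last x p = y]].

Definition deg (R : realType) (X : choiceType) (m : X -> R)
    (b : X -> X -> R) (q : X -> R) (x : X) : R :=
  rsum (b x) + q^\+ x * m x.

Definition degm (R : realType) (X : choiceType) (m : X -> R)
    (b : X -> X -> R) (q : X -> R) (x : X) : R :=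
  deg m b q x / m x.

Definition Cc (R : realType) (X : choiceType) (W : set X) (phi : X -> R) : Prop :=
  finite_set [set x | phi x != 0] /\ forall x, ~ W x -> phi x = 0.

Definition gradsq (R : realType) (X : choiceType) (m : X -> R)
    (b : X -> X -> R) (f : X -> R) (x : X) : R :=
  (2 * m x)^-1 * rsum (fun y => b x y * (f x - f y) ^+ 2).

Definition form (R : realType) (X : choiceType) (m : X -> R)
    (b : X -> X -> R) (q : X -> R) (phi : X -> R) : R :=
  rsum (fun x => (gradsq m b phi x + q x * phi x ^+ 2) * m x).

(* h - lam >= w on C_c(W) *)
Definition form_ge (R : realType) (X : choiceType) (m : X -> R)
    (b : X -> X -> R) (q : X -> R) (lam : R) (w : X -> R) (W : set X) : Prop :=
  forall phi, Cc W phi ->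
    rsum (fun x => w x * phi x ^+ 2 * m x) <=
    form m b q phi - lam * rsum (fun x => phi x ^+ 2 * m x).

Definition form_bounded_below (R : realType) (X : choiceType) (m : X -> R)
    (b : X -> X -> R) (q : X -> R) : Prop :=
  exists C : R, forall phi, Cc [set: X] phi ->
    - C * rsum (fun x => phi x ^+ 2 * m x) <= form m b q phi.

Definition class_V (R : realType) (X : choiceType) (m : X -> R)
    (b : X -> X -> R) (q : X -> R) : Prop :=
  exists eps C : R, [/\ 0 < eps, 0 < C &
    forall phi, Cc [set: X] phi ->
      rsum (fun x => q^\- x * phi x ^+ 2 * m x) <=
      (1 - eps) * form m b q^\+ phi + C * rsum (fun x => phi x ^+ 2 * m x)].

Definition inl2 (R : realType) (X : choiceType) (mu : X -> R) (u : X -> R) : Prop :=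
  (\esum_(x in [set: X]) (u x ^+ 2 * mu x)%:E < +oo)%E.

Definition inF (R : realType) (X : choiceType) (b : X -> X -> R)
    (f : X -> R) : Prop :=
  forall x, (\esum_(y in [set: X]) (b x y * `|f y|)%:E < +oo)%E.

Definition formalH (R : realType) (X : choiceType) (m : X -> R)
    (b : X -> X -> R) (q : X -> R) (f : X -> R) (x : X) : R :=
  (m x)^-1 * rsum (fun y => b x y * (f x - f y)) + q x * f x.

Definition approximable (R : realType) (X : choiceType) (m : X -> R)
    (b : X -> X -> R) (u : X -> R) : Prop :=
  inF b u /\
  exists phi : nat -> X -> R, [/\
    forall n, Cc [set: X] (phi n),
    forall n x, 0 <= phi n x,
    forall n x, phi n x <= phi n.+1 x,
    forall x, phi n x @[n --> \oo] --> (1 : R) &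
    (\esum_(x in [set: X]) (u x ^+ 2 * gradsq m b (phi n) x * m x)%:E)
      @[n --> \oo] --> 0%E].

(* phi is form-Cauchy in C_c(X) and converges to u in l^2(X,m). *)
Definition form_cvg (R : realType) (X : choiceType) (m : X -> R)
    (b : X -> X -> R) (q : X -> R) (phi : nat -> X -> R) (u : X -> R) : Prop :=
  [/\ forall n, Cc [set: X] (phi n),
      (\esum_(x in [set: X]) ((u x - phi n x) ^+ 2 * m x)%:E)
        @[n --> \oo] --> 0%E &
      forall e : R, 0 < e -> exists N : nat, forall n k : nat,
        (N <= n)%N -> (N <= k)%N -> `|form m b q (phi n \- phi k)| < e].

(* The domain D(h) of the closure of the form on C_c(X). *)
Definition form_dom (R : realType) (X : choiceType) (m : X -> R)
    (b : X -> X -> R) (q : X -> R) (u : X -> R) : Prop :=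
  exists phi, form_cvg m b q phi u.

(* The closure of h on D(h): the limit of h along any sequence as in
   [form_cvg]; it does not depend on the sequence since h is closable. *)
Definition cform (R : realType) (X : choiceType) (m : X -> R)
    (b : X -> X -> R) (q : X -> R) (u : X -> R) : R :=
  xget 0 [set l : R | exists phi, form_cvg m b q phi u /\
                        form m b q (phi n) @[n --> \oo] --> l].

Definition cform2 (R : realType) (X : choiceType) (m : X -> R)
    (b : X -> X -> R) (q : X -> R) (u v : X -> R) : R :=
  (cform m b q (u \+ v) - cform m b q (u \- v)) / 4.

(* The domain D(H) of the self-adjoint operator associated with the closed
   form; the function f is Hu. *)
Definition op_dom (R : realType) (X : choiceType) (m : X -> R)
    (b : X -> X -> R) (q : X -> R) (u : X -> R) : Prop :=
  form_dom m b q u /\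
  exists f : X -> R, inl2 m f /\
    forall v, form_dom m b q v ->
      cform2 m b q u v = rsum (fun x => f x * v x * m x).

(* Main.v *)
(* On C_c(~K) the ground state transform
     (h - lam)(u phi) <= 1/2 sum_{x,y} b(x,y) u(x) u(y) (phi x - phi y)^2
   and u(x) u(y) <= (u(x)^2 + u(y)^2) / 2 turn the lower bound a deg_m into
     a sum deg u^2 phi^2 <= sum u^2 |grad phi|^2 m.
   Take phi = g chi with g = exp(r/2 min(|x|, N)) 1_{~K} and chi a cutoff.
   Away from K and its neighbours, |grad g|^2 m <= c g^2 deg where
   c = r^2 (1 + e^r) / 16 < a, by the trapezoid bound
   e^t - 1 <= t (1 + e^t) / 2 at t = r / 2. This term is absorbed on the left,
   and what is left is a bound independent of N and chi.
   In case (b) the lower bound extends to C_c(X) up to a multiple of the l^2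
   norm, so sum deg u^2 is finite for u in D(h), and indicators of large
   finite sets serve as cutoffs. *)
Require Import Defs.
From HB Require Import structures.
From mathcomp Require Import all_boot all_order all_algebra.
From mathcomp Require Import all_classical all_reals all_analysis.
From mathcomp Require Import ring lra.
Set Implicit Arguments.
Unset Strict Implicit.
Unset Printing Implicit Defensive.
Import Order.TTheory GRing.Theory Num.Theory.
Import numFieldNormedType.Exports.
Local Open Scope classical_set_scope.
Local Open Scope ring_scope.

(** * Finite sums over duplicate-free lists, and the infinite sums they determine *)

Section SeqSums.
Variables (R : realType) (X : choiceType).
Implicit Types (f g : X -> R) (s t : seq X).

Lemma ler_sum_seq s f g : {in s, forall x, f x <= g x} ->
  \sum_(x <- s) f x <= \sum_(x <- s) g x.
Proof. by move=> fg; rewrite big_seq [leRHS]big_seq; exact: ler_sum. Qed.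

Lemma ler_sum_uniq s t f : (forall x, 0 <= f x) -> uniq s -> uniq t ->
  (forall x, x \notin t -> f x = 0) ->
  \sum_(x <- s) f x <= \sum_(x <- t) f x.
Proof.
move=> f0 us ut ft.
rewrite (bigID (fun x => x \in t))/= [X in _ + X]big1 ?addr0; last by move=> x /ft.
rewrite -big_filter (perm_big [seq x <- t | x \in s]).
  by rewrite big_filter [leRHS](bigID (fun x => x \in s))/= lerDl sumr_ge0.
by apply: uniq_perm; rewrite ?filter_uniq// => x; rewrite !mem_filter/= andbC.
Qed.

Lemma esum_ub f (B : R) : (forall s, uniq s -> \sum_(x <- s) f x <= B) ->
  (\esum_(x in [set: X]) (f x)%:E <= B%:E)%E.
Proof.
move=> fB; apply: ge_ereal_sup => _ [A [finA _] <-].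
by rewrite fsbig_finite//= sumEFin lee_fin fB.
Qed.

Lemma sum_le_esum s f : uniq s ->
  ((\sum_(x <- s) f x)%:E <= \esum_(x in [set: X]) (f x)%:E)%E.
Proof.
move=> us; apply: esum_ge; exists [set` s]; first by split.
by rewrite -fsbig_seq// sumEFin.
Qed.

Lemma esum_seq s f : (forall x, 0 <= f x) -> uniq s ->
  (forall x, x \notin s -> f x = 0) ->
  \esum_(x in [set: X]) (f x)%:E = (\sum_(x <- s) f x)%:E.
Proof.
move=> f0 us fs; apply/eqP; rewrite eq_le sum_le_esum// andbT.
by apply: esum_ub => t ut; exact: ler_sum_uniq.
Qed.

(** Both parts of [f] vanish off [s], so each [esum] is finite and their difference is meaningful.
    This reduces the energies to finite sums. *)
Lemma rsum_seq s f : uniq s -> (forall x, x \notin s -> f x = 0) ->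
  rsum f = \sum_(x <- s) f x.
Proof.
move=> us fs; rewrite /rsum !(@esum_seq s)//=.
- rewrite -sumrB; apply: eq_bigr => x _.
  by rewrite -[RHS](congr1 (fun h => h x) (funrposBneg f)).
- by move=> x /fs fx; rewrite /funrneg fx oppr0 maxxx.
- by move=> x /fs fx; rewrite /funrpos fx maxxx.
Qed.

Lemma finite_bound s f : exists2 M, 0 <= M & {in s, forall x, f x <= M}.
Proof.
exists (\sum_(x <- s) `|f x|); first exact: sumr_ge0.
move=> x xs; rewrite (big_rem x)//=; apply: (le_trans (ler_norm _)).
by rewrite lerDl sumr_ge0.
Qed.

End SeqSums.

(** * Elementary facts on limits and exponentials *)

Lemma near_cvg0 (R : realType) (f : nat -> \bar R) (d : R) : 0 < d ->
  f n @[n --> \oo] --> 0%E -> \forall n \near \oo, (f n < d%:E)%E.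
Proof.
move=> d0 cf; apply: (cf [set y : \bar R | (y < d%:E)%E]).
exact: (@nbhs_open_ereal_lt _ 0 (fun=> d)).
Qed.

(** The function [F] has [F 0 = -1] and derivative [e^x (e^(-x) - (1 - x)) / 2], which is
    nonnegative; the mean value theorem on [[0, t]] gives [F t >= -1]. *)
Lemma expR_trapezoid (R : realType) (t : R) : 0 <= t ->
  expR t - 1 <= t * (1 + expR t) / 2.
Proof.
move=> t0; pose F (x : R) := x * (1 + expR x) / 2 - expR x.
pose dF (x : R) := (1 + expR x + x * expR x) / 2 - expR x.
have dFP x : is_derive x (1 : R) F (dF x).
  rewrite /F /dF; apply: is_derive_eq.
  by rewrite /GRing.scale/=; field.
have [|c /itvP ct] := @MVT_segment R F dF 0 t t0 (fun x _ => dFP x).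
  by apply: derivable_within_continuous => x _; case: (dFP x).
rewrite /F expR0 mul0r mul0r sub0r opprK subr0 => FE.
have : 0 <= dF c * t.
  rewrite mulr_ge0//; have := expR_ge1Dx (- c); rewrite expRN => h.
  have e0 := expR_gt0 c.
  rewrite (_ : dF c = expR c * ((expR c)^-1 - (1 - c)) / 2).
    by rewrite divr_ge0// mulr_ge0 ?subr_ge0// ltW.
  by rewrite /dF; field; rewrite gt_eqF.
by rewrite -FE; lra.
Qed.

(** After division by [e^s] the claim concerns [1 - w], where [1 / E <= w <= E]. Its modulus is
    largest at [w = E], where the trapezoid bound applies. *)
Lemma expR_sub_sq_le (R : realType) (r s t : R) : 0 <= r ->
  `|s - t| <= r / 2 ->
  (expR s - expR t) ^+ 2 <= 2 * (r ^+ 2 * ((1 + expR r) / 16)) * expR s ^+ 2.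
Proof.
move=> r0; rewrite ler_norml => /andP[h1 h2].
set E := expR (r / 2); set w := expR (t - s).
have Er : expR r = E ^+ 2 by rewrite /E -expRM_natl; congr expR; field.
have -> : expR t = expR s * w by rewrite -expRD; congr expR; ring.
have E1 : 1 <= E by rewrite leNgt expR_lt1 -leNgt; lra.
have wE : w <= E by rewrite ler_expR; lra.
have Ew : 1 <= w * E by rewrite -expRD leNgt expR_lt1 -leNgt; lra.
have hE : E - 1 <= r / 2 * (1 + E) / 2 by apply: expR_trapezoid; lra.
rewrite Er (_ : _ - _ = expR s * (1 - w)); last by ring.
rewrite exprMn [leRHS]mulrC ler_wpM2l ?sqr_ge0//.
apply: (@le_trans _ _ ((E - 1) ^+ 2)).
  (* Multiplied by [E], the right side is at least [E ^ 2 + 1 - 2 E], a square. *)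
  have Ew2 : 0 <= E + w - 2.
    rewrite -(pmulr_rge0 _ (lt_le_trans ltr01 E1)).
    by have := sqr_ge0 (E - 1); nra.
  rewrite -subr_ge0 [leRHS](_ : _ = (E - w) * (E + w - 2)); last by ring.
  by rewrite mulr_ge0// subr_ge0.
apply: (@le_trans _ _ ((r / 2 * (1 + E) / 2) ^+ 2)).
  by rewrite ler_sqr ?nnegrE; nra.
(* This is the gap in [(1 + E) ^ 2 <= 2 (1 + E ^ 2)]. *)
rewrite -subr_ge0 [leRHS](_ : _ = (r / 4) ^+ 2 * (E - 1) ^+ 2); last by field.
by rewrite mulr_ge0 ?sqr_ge0.
Qed.

(** * The combinatorial distance changes by at most one along an edge *)

Section Distance.
Variables (R : realType) (X : choiceType) (b : X -> X -> R) (o : X).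
Hypothesis conn : connected_graph b.

Let lengths (x : X) : set R :=
  [set (size p)%:R | p in [set p : seq X | path (adj b) o p /\ last o p = x]].

Let lengths_lb x : has_lbound (lengths x).
Proof. by exists 0 => _ [p _ <-]; rewrite ler0n. Qed.

Let lengths_n0 x : lengths x !=set0.
Proof. by have [p pP] := conn o x; exists (size p)%:R; exists p. Qed.

Lemma dist_ge0 x : 0 <= dist b o x.
Proof. by apply: lb_le_inf => [|_ [p _ <-]]; [exact: lengths_n0|]. Qed.

Lemma dist_adj x y : adj b x y -> dist b o y <= dist b o x + 1.
Proof.
move=> xy; rewrite -lerBlDr; apply: lb_le_inf; first exact: lengths_n0.
move=> _ [p [po px] <-]; rewrite lerBlDr natr1.
apply: ge_inf; first exact: lengths_lb.
exists (rcons p y); last by rewrite size_rcons.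
by rewrite /= rcons_path last_rcons po px.
Qed.

End Distance.

(** * Supports, neighbour lists and the energy as a finite sum *)

Section Graph.
Variables (R : realType) (X : countType) (m : X -> R) (b : X -> X -> R).
Variables (q : X -> R) (nb : X -> seq X).
Hypotheses (m_gt0 : forall x, 0 < m x) (bG : is_graph b).
Hypothesis nbP : forall x y, y \notin nb x -> b x y = 0.
Implicit Types (phi psi u : X -> R) (s : seq X) (x y : X).

Let b0 x y : 0 <= b x y := graph_ge0 bG x y.
Let bC x y : b x y = b y x := graph_sym bG x y.

(** Containing the neighbours of the support as well, [s] meets every edge on which [phi] varies in
    both endpoints, so energies are double sums over [s]. The lists [nb x] may repeat entries or
    contain non-neighbours. *)
Definition covers s phi :=
  uniq s /\ forall x, phi x != 0 -> x \in s /\ {subset nb x <= s}.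

Definition hull s : seq X := undup (s ++ flatten (map nb s)).

Lemma hull_uniq s : uniq (hull s). Proof. exact: undup_uniq. Qed.

Lemma sub_hull s : {subset s <= hull s}.
Proof. by move=> x xs; rewrite mem_undup mem_cat xs. Qed.

Lemma nb_hull s x y : x \in s -> y \in nb x -> y \in hull s.
Proof.
move=> xs yx; rewrite mem_undup mem_cat; apply/orP; right.
by apply/flattenP; exists (nb x) => //; exact: map_f.
Qed.

Lemma covers_hull s phi : (forall x, phi x != 0 -> x \in s) ->
  covers (hull s) phi.
Proof.
move=> sp; split=> [|x /sp xs]; first exact: hull_uniq.
by split; [exact: sub_hull|move=> y; exact: nb_hull].
Qed.

(** Allows one list to serve for all functions built from [phi] by multiplication or restriction. *)
Lemma covers_sub s phi psi : covers s phi ->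
  (forall x, phi x = 0 -> psi x = 0) -> covers s psi.
Proof.
move=> [us sp] pp; split=> // x px; apply: sp.
by apply: contra px => /eqP/pp ->.
Qed.

Lemma Cc_covers W phi : Cc W phi -> exists s, covers s phi.
Proof.
move=> [/finite_seqP[s sE] _]; exists (hull s); apply: covers_hull => x px.
by have : [set x | phi x != 0] x by []; rewrite sE.
Qed.

Lemma covers_Cc W s phi : covers s phi -> (forall x, ~ W x -> phi x = 0) ->
  Cc W phi.
Proof.
move=> [_ sp] W0; split=> //; apply: (@sub_finite_set _ _ [set` s]) => //.
by move=> x /= /sp[].
Qed.

Lemma covers0 s phi x : covers s phi -> x \notin s -> phi x = 0.
Proof. by case=> _ sp; apply: contraNeq => /sp[]. Qed.

Lemma covers_b0 s phi x y : covers s phi -> y \notin s -> phi x != 0 ->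
  b x y = 0.
Proof. by case=> _ sp ys /sp[_ xs]; apply/nbP; apply: contra ys; exact: xs. Qed.

Lemma sum_b_le s x : uniq s -> \sum_(y <- s) b x y <= rsum (b x).
Proof.
move=> us; rewrite (@rsum_seq _ _ (undup (nb x))) ?undup_uniq//.
  by apply: ler_sum_uniq; rewrite ?undup_uniq// => y; rewrite mem_undup => /nbP.
by move=> y; rewrite mem_undup => /nbP.
Qed.

Lemma rsum_b_ge0 x : 0 <= rsum (b x).
Proof. by rewrite (le_trans _ (@sum_b_le [::] x _))// big_nil. Qed.

Lemma rsum_b_le_deg x : rsum (b x) <= deg m b q x.
Proof. by rewrite /deg lerDl mulr_ge0 ?funrpos_ge0// ltW. Qed.

Lemma deg_ge0 x : 0 <= deg m b q x.
Proof. exact: le_trans (rsum_b_ge0 x) (rsum_b_le_deg x). Qed.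

(** Holds for [x] outside [s] too: for [y] off [s], either both values vanish or [b x y = 0]. *)
Lemma gradsq_seq s phi x : covers s phi ->
  gradsq m b phi x * m x = 2^-1 * \sum_(y <- s) b x y * (phi x - phi y) ^+ 2.
Proof.
move=> sp; rewrite /gradsq (@rsum_seq _ _ s); [|by case: sp|].
  by have mx := m_gt0 x; field; rewrite gt_eqF.
move=> y ys; have [px|px] := eqVneq (phi x) 0.
  by rewrite px (covers0 sp ys) subrr expr0n mulr0.
by rewrite (covers_b0 sp ys px) mul0r.
Qed.

Lemma gradsq_out s phi x : covers s phi -> x \notin s ->
  gradsq m b phi x * m x = 0.
Proof.
move=> sp xs; rewrite (gradsq_seq _ sp) big1 ?mulr0// => y _.
rewrite (covers0 sp xs); have [->|py] := eqVneq (phi y) 0.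
  by rewrite subrr expr0n mulr0.
by rewrite bC (covers_b0 sp xs py) mul0r.
Qed.

Lemma rsum_sq s phi (w : X -> R) : covers s phi ->
  rsum (fun x => w x * phi x ^+ 2 * m x) =
  \sum_(x <- s) w x * phi x ^+ 2 * m x.
Proof.
move=> sp; apply: rsum_seq => [|x xs]; first by case: sp.
by rewrite (covers0 sp xs) expr0n mulr0 mul0r.
Qed.

Lemma rsum_sq1 s phi : covers s phi ->
  rsum (fun x => phi x ^+ 2 * m x) = \sum_(x <- s) phi x ^+ 2 * m x.
Proof.
move=> sp; apply: rsum_seq => [|x xs]; first by case: sp.
by rewrite (covers0 sp xs) expr0n mul0r.
Qed.

Lemma form_seq s phi : covers s phi ->
  Defs.form m b q phi =
  2^-1 * (\sum_(x <- s) \sum_(y <- s) b x y * (phi x - phi y) ^+ 2) +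
  \sum_(x <- s) q x * phi x ^+ 2 * m x.
Proof.
move=> sp; rewrite /Defs.form (@rsum_seq _ _ s); [|by case: sp|].
  rewrite mulr_sumr -big_split/=; apply: eq_bigr => x _.
  by rewrite mulrDl (gradsq_seq _ sp).
move=> x xs; rewrite mulrDl (gradsq_out sp xs) add0r.
by rewrite (covers0 sp xs) expr0n mulr0 mul0r.
Qed.

Lemma form_parallelogram s phi psi : covers s phi -> covers s psi ->
  Defs.form m b q (phi \+ psi) + Defs.form m b q (phi \- psi) =
  2 * Defs.form m b q phi + 2 * Defs.form m b q psi.
Proof.
move=> sp sq.
have sD h : (forall x, phi x = 0 -> psi x = 0 -> h x = 0) -> covers s h.
  move=> hE; split=> [|x hx]; first by case: sp.
  have [px|px] := eqVneq (phi x) 0; last by case: sp => _; apply.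
  case: sq => _; apply; apply: contra hx => /eqP qx; exact/eqP/hE.
rewrite !(@form_seq s)//; last 2 first.
- by apply: sD => x /= -> ->; rewrite subrr.
- by apply: sD => x /= -> ->; rewrite addr0.
rewrite !mulr_sumr -!big_split/= !mulr_sumr -big_split/=.
apply: eq_bigr => x _.
rewrite addrACA 2!mulrDr [RHS]addrACA; congr (_ + _)%R.
  rewrite !mulr_sumr -!big_split/= ?mulr_sumr -?big_split/=.
  by apply: eq_bigr => y _; field.
by field.
Qed.

(** By [(c - d)^2 <= 2 c^2 + 2 d^2] and the symmetry of [b], the energy is at most twice the degree
    sum. This later controls the part of a function living on [K]. *)
Lemma form_le s phi : covers s phi ->
  Defs.form m b q phi <=
  \sum_(x <- s) (2 * rsum (b x) + q x * m x) * phi x ^+ 2.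
Proof.
move=> sp; rewrite (form_seq sp).
have us : uniq s by case: sp.
have le1 : \sum_(x <- s) \sum_(y <- s) b x y * (phi x - phi y) ^+ 2 <=
    4 * \sum_(x <- s) rsum (b x) * phi x ^+ 2.
  apply: (@le_trans _ _ (2 * \sum_(x <- s) \sum_(y <- s) b x y * phi x ^+ 2 +
      2 * \sum_(x <- s) \sum_(y <- s) b x y * phi y ^+ 2)).
    rewrite !mulr_sumr -big_split/=; apply: ler_sum => x _.
    rewrite !mulr_sumr -big_split/=; apply: ler_sum => y _.
    rewrite !(mulrCA 2) -mulrDr ler_wpM2l// -subr_ge0.
    rewrite (_ : _ - _ = (phi x + phi y) ^+ 2) ?sqr_ge0//; ring.
  rewrite [X in _ + 2 * X]exchange_big/=.
  rewrite [X in _ + 2 * X](eq_bigr (fun x => \sum_(y <- s) b x y * phi x ^+ 2)); last first.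
    by move=> x _; apply: eq_bigr => y _; rewrite bC.
  rewrite -mulrDl -natrD ler_wpM2l//; apply: ler_sum => x _.
  by rewrite -mulr_suml ler_wpM2r ?sqr_ge0// sum_b_le.
apply: (@le_trans _ _ (2^-1 * (4 * \sum_(x <- s) rsum (b x) * phi x ^+ 2) +
  \sum_(x <- s) q x * phi x ^+ 2 * m x)); first by rewrite lerD2r ler_pM2l.
rewrite !mulr_sumr -big_split/= le_eqVlt; apply/orP; left; apply/eqP.
by apply: eq_bigr => x _; field.
Qed.

(** * Ground state estimate and coercivity *)

Lemma sumsum_sym s (F : X -> X -> R) :
  \sum_(x <- s) \sum_(y <- s) b x y * F y x =
  \sum_(x <- s) \sum_(y <- s) b x y * F x y.
Proof.
rewrite exchange_big/=; apply: eq_bigr => x _; apply: eq_bigr => y _.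
by rewrite bC.
Qed.

(** The lower bound is tested with [u phi], the equation with [u phi^2]. Only the product of [u]
    with [(H - lam) u] enters, so solutions and nonnegative subsolutions are treated together. *)
Lemma form_ge_caccioppoli (a lam : R) (K : set X) u phi s :
  form_ge m b q lam (fun x => a * degm m b q x) (~` K) ->
  covers s phi -> (forall x, K x -> phi x = 0) ->
  (forall x, ~ K x -> (formalH m b q u x - lam * u x) * u x <= 0) ->
  a * \sum_(x <- s) deg m b q x * (u x * phi x) ^+ 2 <=
  2^-1 * \sum_(x <- s) \sum_(y <- s)
    b x y * (u x ^+ 2 * (phi x - phi y) ^+ 2).
Proof.
move=> hge sp pK uH.
have sup : covers s (fun x => u x * phi x).
  by apply: covers_sub sp _ => x ->; rewrite mulr0.
have /hge : Cc (~` K) (fun x => u x * phi x).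
  apply: covers_Cc sup _ => x /contrapT Kx; by rewrite pK// mulr0.
rewrite (rsum_sq _ sup) (rsum_sq1 sup) (form_seq sup) => h1.
have h2 : \sum_(x <- s) (\sum_(y <- s) b x y * (u x - u y) +
    (q x - lam) * u x * m x) * u x * phi x ^+ 2 <= 0.
  rewrite -oppr_ge0 -sumrN; apply: sumr_ge0 => x _; rewrite oppr_ge0.
  have [->|px] := eqVneq (phi x) 0; first by rewrite expr0n mulr0.
  have nKx : ~ K x by move=> /pK /eqP; exact/negP.
  rewrite mulr_le0_ge0 ?sqr_ge0//.
  rewrite (_ : _ * u x = (formalH m b q u x - lam * u x) * u x * m x).
    by rewrite mulr_le0_ge0 ?uH// ltW.
  rewrite /formalH (@rsum_seq _ _ s); [|by case: sp|].
    by have mx := m_gt0 x; field; rewrite gt_eqF.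
  by move=> y ys; rewrite (covers_b0 sp ys px) mul0r.
set D := \sum_(x <- s) deg m b q x * (u x * phi x) ^+ 2.
set Q := \sum_(x <- s) (q x - lam) * (u x * phi x) ^+ 2 * m x.
have {}h1 : a * D <= 2^-1 * (\sum_(x <- s) \sum_(y <- s)
    b x y * (u x * phi x - u y * phi y) ^+ 2) + Q.
  move: h1; rewrite mulr_sumr -addrA -sumrB.
  rewrite (eq_bigr (fun x => a * (deg m b q x * (u x * phi x) ^+ 2))); last first.
    by move=> x _; rewrite /degm; have mx := m_gt0 x; field; rewrite gt_eqF.
  rewrite -mulr_sumr => /le_trans; apply; rewrite lerD2l le_eqVlt.
  by apply/orP; left; apply/eqP/eq_bigr => x _; rewrite !mulrBl !mulrA.
set A := \sum_(x <- s) \sum_(y <- s) b x y * (u x * (u x - u y) * phi x ^+ 2).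
have {}h2 : A + Q <= 0.
  apply: le_trans h2; rewrite le_eqVlt; apply/orP; left; apply/eqP.
  rewrite -big_split/=; apply: eq_bigr => x _.
  transitivity ((\sum_(y <- s) b x y * (u x - u y)) * (u x * phi x ^+ 2) +
      (q x - lam) * (u x * phi x) ^+ 2 * m x); last by ring.
  by rewrite mulr_suml; congr (_ + _); apply: eq_bigr => y _; ring.
apply: (le_trans h1).
(* By [A + Q <= 0] the potential term [Q] is traded for the edge term [-A]. *)
apply: (@le_trans _ _ (2^-1 * (\sum_(x <- s) \sum_(y <- s)
    b x y * (u x * phi x - u y * phi y) ^+ 2) - A)).
  by rewrite lerD2l -subr_le0 opprK addrC.
(* Averaging [A] with its transpose makes each summand symmetric, so that edges can be compared one
   by one. *)
rewrite (_ : A = 2^-1 * (A + \sum_(x <- s) \sum_(y <- s) b x y * (u y * (u y - u x) * phi y ^+ 2))); last first.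
  by rewrite (sumsum_sym s (fun x y => u x * (u x - u y) * phi x ^+ 2)) -/A; field.
rewrite -mulrBr ler_pM2l//.
rewrite [leRHS](_ : _ = 2^-1 * (
    \sum_(x <- s) \sum_(y <- s) b x y * (u x ^+ 2 * (phi x - phi y) ^+ 2) +
    \sum_(x <- s) \sum_(y <- s)
      b x y * (u y ^+ 2 * (phi y - phi x) ^+ 2))); last first.
  by rewrite (sumsum_sym s (fun x y => u x ^+ 2 * (phi x - phi y) ^+ 2)); field.
rewrite /A -!big_split/= -sumrB mulr_sumr; apply: ler_sum => x _.
rewrite -big_split/= -big_split/= -sumrB mulr_sumr; apply: ler_sum => y _.
(* The left side is [b x y] times [u x u y (phi x - phi y)^2]; the gap comes from replacing
   [u x u y] by the mean of the squares. *)
rewrite -subr_ge0 (_ : _ - _ =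
    b x y * (2^-1 * ((u x - u y) * (phi x - phi y)) ^+ 2)); last by field.
by rewrite mulr_ge0// mulr_ge0 ?sqr_ge0.
Qed.

(* h + C is a nonnegative form, so by the parallelogram law
   h(1_{~K} phi) <= 2 h(phi) + 2 h(1_K phi) + C' |phi|^2. *)
Lemma form_coercive (a lam : R) (K : set X) : 0 <= a -> finite_set K ->
  form_bounded_below m b q ->
  form_ge m b q lam (fun x => a * degm m b q x) (~` K) ->
  exists C : R, forall s phi, covers s phi ->
    a * \sum_(x <- s) deg m b q x * phi x ^+ 2 <=
    2 * Defs.form m b q phi + C * \sum_(x <- s) phi x ^+ 2 * m x.
Proof.
move=> a0 /finite_seqP[k kE] [C0 hC0] hge.
have [M1 M10 hM1] := finite_bound k (fun x => (2 * rsum (b x) + q x * m x) / m x).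
have [M2 M20 hM2] := finite_bound k (fun x => deg m b q x / m x).
(* In order: twice the energy of the part on [K], the lower bound at [phi + kap] with
   [(phi + kap)^2 <= 4 phi^2], the shift by [lam], and the degree on [K]. *)
exists (2 * M1 + 4 * `|C0| + `|lam| + a * M2) => s phi sp.
pose kap x := if x \in k then phi x else 0.
pose psi x := if x \in k then 0 else phi x.
have sk : covers s kap by apply: covers_sub sp _ => x; rewrite /kap; case: ifP.
have ss : covers s psi by apply: covers_sub sp _ => x; rewrite /psi; case: ifP.
have spk : covers s (phi \+ kap).
  by apply: covers_sub sp _ => x /= p0; rewrite /kap p0 if_same addr0.
have psiE : phi \- kap = psi.
  by apply/funext => x; rewrite /kap /psi /=; case: ifP; rewrite ?subrr ?subr0.
have := form_parallelogram sp sk; rewrite psiE => par.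
set S := \sum_(x <- s) phi x ^+ 2 * m x.
have S0 : 0 <= S by apply: sumr_ge0 => x _; rewrite mulr_ge0 ?sqr_ge0// ltW.
have le_kap : Defs.form m b q kap <= M1 * S.
  apply: (le_trans (form_le sk)); rewrite mulr_sumr; apply: ler_sum => x _.
  rewrite /kap; case: ifPn => xk; last first.
    by rewrite expr0n mulr0 mulr_ge0// mulr_ge0 ?sqr_ge0// ltW.
  rewrite mulrC [leRHS]mulrCA ler_wpM2l ?sqr_ge0//.
  by rewrite -ler_pdivrMr// hM1.
have le_spk : - (4 * `|C0| * S) <= Defs.form m b q (phi \+ kap).
  have /hC0 : Cc [set: X] (phi \+ kap) by apply: covers_Cc spk _ => x [].
  rewrite (rsum_sq1 spk); apply: le_trans; rewrite mulNr lerN2.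
  set S' := \sum_(_ <- _) _.
  have S'0 : 0 <= S' by apply: sumr_ge0 => x _; rewrite mulr_ge0 ?sqr_ge0// ltW.
  apply: (@le_trans _ _ (`|C0| * S')); first by rewrite ler_wpM2r// ler_norm.
  rewrite -mulrA mulrCA ler_wpM2l// mulr_sumr; apply: ler_sum => x _ /=.
  rewrite mulrA ler_wpM2r ?(ltW (m_gt0 x))// /kap; case: ifP => _.
    by rewrite -subr_ge0 (_ : _ - _ = 0)//; ring.
  by rewrite addr0 ler_peMl ?sqr_ge0// ler1n.
have le_psi : a * \sum_(x <- s) deg m b q x * psi x ^+ 2 <=
    Defs.form m b q psi + `|lam| * S.
  have /hge : Cc (~` K) psi.
    apply: covers_Cc ss _ => x /contrapT; rewrite kE /psi/= => ->.
    by [].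
  rewrite (rsum_sq _ ss) (rsum_sq1 ss) => h.
  apply: (@le_trans _ _ (\sum_(x <- s) a * degm m b q x * psi x ^+ 2 * m x)).
    rewrite mulr_sumr le_eqVlt; apply/orP; left; apply/eqP.
    apply: eq_bigr => x _; rewrite /degm; have := m_gt0 x => mx.
    by field; rewrite gt_eqF.
  apply: (le_trans h); rewrite lerD2l -mulNr.
  set S' := \sum_(_ <- _) _.
  have S'0 : 0 <= S' by apply: sumr_ge0 => x _; rewrite mulr_ge0 ?sqr_ge0// ltW.
  apply: (@le_trans _ _ (`|lam| * S')).
    by rewrite ler_wpM2r// -normrN ler_norm.
  rewrite ler_wpM2l//; apply: ler_sum => x _.
  rewrite ler_wpM2r ?(ltW (m_gt0 x))// /psi; case: ifP => _ //.
  by rewrite expr0n sqr_ge0.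
have le_deg : \sum_(x <- s) deg m b q x * phi x ^+ 2 <=
    \sum_(x <- s) deg m b q x * psi x ^+ 2 + M2 * S.
  rewrite mulr_sumr -big_split/=; apply: ler_sum => x _.
  rewrite /psi; case: ifPn => xk; last first.
    by rewrite lerDl mulr_ge0// mulr_ge0 ?sqr_ge0// ltW.
  rewrite expr0n mulr0 add0r mulrC [leRHS]mulrCA ler_wpM2l ?sqr_ge0//.
  by rewrite -ler_pdivrMr// hM2.
have := ler_wpM2l a0 le_deg; rewrite mulrDr.
move: par le_kap le_spk le_psi.
set d1 := \sum_(_ <- _) _; set d2 := \sum_(_ <- _) _.
set f1 := Defs.form _ _ _ _; set f2 := Defs.form _ _ _ _.
set f3 := Defs.form _ _ _ _; set f4 := Defs.form _ _ _ _.
by rewrite !mulrDl; lra.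
Qed.

(** * Degree-weighted summability on the form domain, and cutoff functions *)

(** Split [u = phi N + (phi n - phi N) + (u - phi n)]. Coercivity bounds the middle term uniformly
    in [n]; the last is small on the given [s] once [n] is large. [N] is fixed before [s], hence a
    uniform bound. *)
Lemma form_dom_deg (a lam : R) (K : set X) u : 0 < a -> finite_set K ->
  form_bounded_below m b q ->
  form_ge m b q lam (fun x => a * degm m b q x) (~` K) ->
  form_dom m b q u ->
  exists B : R, forall s, uniq s -> \sum_(x <- s) deg m b q x * u x ^+ 2 <= B.
Proof.
move=> a0 finK hbd hge [phi [Cphi cvu cau]].
have [C hC] := form_coercive (ltW a0) finK hbd hge.
have l2 (e : R) : 0 < e -> exists N, forall n s, (N <= n)%N -> uniq s ->
    \sum_(x <- s) (u x - phi n x) ^+ 2 * m x <= e.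
  move=> e0; have [N _ hN] := near_cvg0 e0 cvu.
  exists N => n s Nn us; rewrite -lee_fin.
  exact: le_trans (sum_le_esum _ us) (ltW (hN _ Nn)).
have [N1 hN1] := l2 _ ltr01; have [N2 hN2] := cau _ ltr01.
set N := maxn N1 N2.
have [s0 s0P] := Cc_covers (Cphi N).
(* The 3 is from squaring a sum of three terms. In [2 + |C| 4], the form difference is below 1 and
   the squared [l^2] distance of [phi n] and [phi N] is at most [2 + 2]. *)
exists (3 * (\sum_(x <- s0) deg m b q x * phi N x ^+ 2 +
  a^-1 * (2 + `|C| * 4) + 1)) => s us.
have [M M0 hM] := finite_bound s (fun x => deg m b q x / m x).
have M1 : 0 < (M + 1)^-1 by rewrite invr_gt0 ltr_wpDl.
have [N3 hN3] := l2 _ M1.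
set n := maxn N N3.
have Nn : (N <= n)%N by exact: leq_maxl.
have [t1 t1P] := Cc_covers (Cphi n).
have [t tP] : exists t, covers t (phi n \- phi N).
  apply: (@Cc_covers [set: X]); split=> [|x []//].
  apply: (@sub_finite_set _ _ [set` t1 ++ s0]) => //.
  move=> x /=; apply: contraNT; rewrite mem_cat negb_or => /andP[x1 x0].
  by rewrite (covers0 t1P)// (covers0 s0P)// subrr.
have ut : uniq t by case: tP.
have le_diff : \sum_(x <- t) deg m b q x * (phi n x - phi N x) ^+ 2 <=
    a^-1 * (2 + `|C| * 4).
  rewrite mulrC ler_pdivlMr// mulrC; apply: (le_trans (hC _ _ tP)).
  have := hN2 n N (leq_trans (leq_maxr _ _) Nn) (leq_maxr _ _).
  move=> /ltW /(le_trans (ler_norm _)) f1.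
  apply: lerD; first by rewrite ler_piMr.
  set S := \sum_(_ <- _) _.
  have S0 : 0 <= S by apply: sumr_ge0 => x _; rewrite mulr_ge0 ?sqr_ge0// ltW.
  apply: (@le_trans _ _ (`|C| * S)); first by rewrite ler_wpM2r// ler_norm.
  rewrite ler_wpM2l//.
  have h1 := hN1 n t (leq_trans (leq_maxl _ _) Nn) ut.
  have h2 := hN1 N t (leq_maxl _ _) ut.
  apply: (@le_trans _ _ (2 * \sum_(x <- t) (u x - phi n x) ^+ 2 * m x +
      2 * \sum_(x <- t) (u x - phi N x) ^+ 2 * m x)); last by lra.
  rewrite !mulr_sumr -big_split/=; apply: ler_sum => x _ /=.
  rewrite !mulrA -mulrDl ler_wpM2r ?(ltW (m_gt0 x))// -subr_ge0.
  rewrite [leRHS](_ : _ = (2 * u x - phi n x - phi N x) ^+ 2); last by ring.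
  exact: sqr_ge0.
have le_tail : \sum_(x <- s) deg m b q x * (u x - phi n x) ^+ 2 <= 1.
  apply: (@le_trans _ _ (M * \sum_(x <- s) (u x - phi n x) ^+ 2 * m x)).
    rewrite mulr_sumr; apply: ler_sum_seq => x xs.
    rewrite mulrC [leRHS]mulrCA ler_wpM2l ?sqr_ge0//.
    by rewrite -ler_pdivrMr// hM.
  apply: (le_trans (ler_wpM2l M0 (hN3 n s (leq_maxr _ _) us))).
  by rewrite ler_pdivrMr ?mul1r ?lerDl// ltr_wpDl.
have deg0 := deg_ge0.
have le_N : \sum_(x <- s) deg m b q x * phi N x ^+ 2 <=
    \sum_(x <- s0) deg m b q x * phi N x ^+ 2.
  apply: ler_sum_uniq => //; first by move=> x; rewrite mulr_ge0 ?sqr_ge0.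
    by case: s0P.
  by move=> x xs; rewrite (covers0 s0P)// expr0n mulr0.
have le_d : \sum_(x <- s) deg m b q x * (phi n x - phi N x) ^+ 2 <=
    \sum_(x <- t) deg m b q x * (phi n x - phi N x) ^+ 2.
  apply: ler_sum_uniq => //; first by move=> x; rewrite mulr_ge0 ?sqr_ge0.
  by move=> x /(covers0 tP)/= ->; rewrite expr0n mulr0.
apply: (@le_trans _ _ (3 * (\sum_(x <- s) deg m b q x * phi N x ^+ 2 +
   \sum_(x <- s) deg m b q x * (phi n x - phi N x) ^+ 2 +
   \sum_(x <- s) deg m b q x * (u x - phi n x) ^+ 2))); last by lra.
rewrite -!big_split/= mulr_sumr; apply: ler_sum => x _.
rewrite -!mulrDr [leRHS]mulrCA ler_wpM2l//.
have sq3 (c d e : R) : (c + d + e) ^+ 2 <= 3 * (c ^+ 2 + d ^+ 2 + e ^+ 2).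
  rewrite -subr_ge0.
  rewrite [leRHS](_ : _ = (c - d) ^+ 2 + (d - e) ^+ 2 + (c - e) ^+ 2).
    by rewrite !addr_ge0 ?sqr_ge0.
  by ring.
have {1}-> : u x = phi N x + (phi n x - phi N x) + (u x - phi n x) by ring.
exact: sq3.
Qed.

(* What remains of approximability: no monotonicity, and 1/2 in place of the
   limit 1, so that no passage to the limit is needed in exp_decay. *)
Definition has_cutoffs u := forall (k : seq X) (d : R), 0 < d ->
  exists chi : X -> R, [/\ Cc [set: X] chi, forall x, 0 <= chi x <= 1,
    {in k, forall x, 2^-1 <= chi x} &
    forall s, uniq s ->
      \sum_(x <- s) u x ^+ 2 * (gradsq m b chi x * m x) <= d].

(** A late term of the approximating sequence works: monotone convergence keeps it below 1, and on a
    finite list it eventually exceeds 1/2. *)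
Lemma approximable_cutoffs u : approximable m b u -> has_cutoffs u.
Proof.
move=> [_ [phi [Cphi phi0 phiS phi1 cv]]] k d d0.
have phi_le1 n x : phi n x <= 1.
  have nd : nondecreasing_seq (phi ^~ x).
    by apply/nondecreasing_seqP => i; exact: phiS.
  rewrite -(cvg_lim (@Rhausdorff R) (phi1 x)).
  apply: nondecreasing_cvgn_le => //; apply/cvg_ex; exists 1; exact: phi1.
have near_k : \forall n \near \oo, {in k, forall x, 2^-1 <= phi n x}.
  elim: k => [|x k IH]; first by near=> n => y; rewrite in_nil.
  have hx : \forall n \near \oo, 2^-1 <= phi n x.
    by apply: (cvgr_ge 1 (phi1 x)); rewrite invf_lt1// ltr1n.
  near=> n => y; rewrite inE => /predU1P[->|yk]; first by near: n.
  have : {in k, forall z, 2^-1 <= phi n z} by near: n.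
  exact.
have [N _ hN] := filterI near_k (near_cvg0 d0 cv).
have [hk hd] := hN N (leqnn N).
exists (phi N); split=> // [x|s us]; first by rewrite phi0 phi_le1.
rewrite -lee_fin; apply: le_trans (ltW hd).
under eq_bigr do rewrite mulrA.
exact: (sum_le_esum (fun x => u x ^+ 2 * gradsq m b (phi N) x * m x)).
Unshelve. all: by end_near. Qed.

(** A finite set [e] carries all but [d] of the sum of [deg u^2]. A cutoff with zero gradient on [e]
    and [|grad chi|^2 m <= deg] elsewhere has energy at most the tail. *)
Lemma deg_cutoffs u (B : R) :
  (forall s, uniq s -> \sum_(x <- s) deg m b q x * u x ^+ 2 <= B) ->
  has_cutoffs u.
Proof.
move=> hB k d d0.
pose w x := deg m b q x * u x ^+ 2.
have w0 x : 0 <= w x by rewrite mulr_ge0 ?sqr_ge0// deg_ge0.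
pose E := [set \sum_(x <- s) w x | s in [set s | uniq s]].
have supE : has_sup E.
  split; first by exists (\sum_(x <- [::]) w x); exists [::].
  by exists B => _ [s us <-]; exact: hB.
have [_ [e ue <-] he] := sup_adherent d0 supE.
pose l := undup (e ++ k).
(* The hull makes [chi] equal 1 at every neighbour of [l], so the gradient vanishes on all of
   [l]. *)
pose chi x : R := (x \in hull l)%:R.
have chiP : covers (hull (hull l)) chi.
  by apply: covers_hull => x; rewrite /chi; case: (x \in hull l); rewrite ?eqxx.
exists chi; split.
- by apply: covers_Cc chiP _ => x [].
- by move=> x; rewrite /chi; case: (x \in _); rewrite ?lexx ler01.
- move=> x xk; rewrite /chi sub_hull ?mem_undup ?mem_cat ?xk ?orbT//.
  by rewrite invf_le1// ler1n.
move=> s us.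
have tail : \sum_(x <- [seq x <- s | x \notin e]) w x <= d.
  have ut : uniq ([seq x <- s | x \notin e] ++ e).
    rewrite cat_uniq filter_uniq// ue andbT/=; apply/hasPn => x xe.
    by rewrite mem_filter/= xe.
  have : \sum_(x <- [seq x <- s | x \notin e] ++ e) w x <= sup E.
    by apply: sup_ubound; [case: supE|exists ([seq x <- s | x \notin e] ++ e)].
  by rewrite big_cat/=; move: he; lra.
apply: le_trans tail; rewrite big_filter [leRHS]big_mkcond/=.
apply: ler_sum => x _; rewrite (gradsq_seq _ chiP).
case: ifPn => [xe|/negPn xe].
  rewrite mulrC /w ler_wpM2r ?sqr_ge0//.
  apply: (@le_trans _ _ (2^-1 * \sum_(y <- hull (hull l)) b x y)).
    rewrite ler_pM2l//; apply: ler_sum => y _; rewrite ler_piMr ?b0//.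
    by rewrite /chi; do 2!case: (_ \in _); rewrite ?subrr ?subr0 ?sub0r ?sqrrN ?expr1n ?expr0n ?ler01.
  rewrite (le_trans _ (rsum_b_le_deg x))// (le_trans _ (sum_b_le x (hull_uniq (hull l))))//.
  by rewrite ler_piMl ?invf_le1 ?ler1n// sumr_ge0.
have xl : x \in l by rewrite mem_undup mem_cat xe.
rewrite big1 ?mulr0// => y _; have [yx|yx] := boolP (y \in nb x).
  by rewrite /chi (nb_hull xl yx) sub_hull// subrr expr0n mulr0.
by rewrite nbP// mul0r.
Qed.

(** * The exponentially weighted estimate *)

Lemma exp_decay (a lam r : R) (K : set X) (rho : X -> R) u :
  0 < r -> r ^+ 2 * ((1 + expR r) / 16) < a -> finite_set K ->
  form_ge m b q lam (fun x => a * degm m b q x) (~` K) ->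
  (forall x, ~ K x -> (formalH m b q u x - lam * u x) * u x <= 0) ->
  has_cutoffs u ->
  (forall x, 0 <= rho x) ->
  (forall x y, 0 < b x y -> rho y <= rho x + 1) ->
  exists B : R, forall s, uniq s ->
    \sum_(x <- s) u x ^+ 2 * (expR (r * rho x) * deg m b q x) <= B.
Proof.
set c := r ^+ 2 * _ => r0 ca /finite_seqP[k kE] hge uH cut rho0 rho1.
have c0 : 0 < c by rewrite mulr_gt0 ?exprn_gt0// divr_gt0// addr_gt0// expR_gt0.
have deg0 := deg_ge0.
(* Chosen so that [(1 + eps) c] is the midpoint of [a] and [c]; absorption then leaves the factor
   [(a - c) / 2]. *)
pose eps := (a - c) / (2 * c).
have eps0 : 0 < eps by rewrite divr_gt0 ?subr_gt0// mulr_gt0.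
have epsc : (1 + eps) * c = (a + c) / 2 by rewrite /eps; field; rewrite gt_eqF.
(* Young's inequality: [(p + z)^2 <= (1 + eps) p^2 + eta z^2]. *)
pose eta := 1 + eps^-1.
have eta0 : 0 < eta by rewrite addr_gt0// invr_gt0.
pose W x := u x ^+ 2 * (expR (r * (rho x + 1)) * deg m b q x).
have W0 x : 0 <= W x by rewrite mulr_ge0 ?sqr_ge0// mulr_ge0 ?expR_ge0.
pose V x := u x ^+ 2 * (expR (r * rho x) * deg m b q x).
have V0 x : 0 <= V x by rewrite mulr_ge0 ?sqr_ge0// mulr_ge0 ?expR_ge0.
pose CT := \sum_(x <- hull k) W x.
(* The 4 pays for [chi >= 1/2], the 1 is the cutoff error, and the last sum covers the points of
   [K], where [phi] vanishes. *)
exists (4 * (((1 + eps) * CT + 1) / ((a - c) / 2)) + \sum_(x <- undup k) V x) => s us.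
have [N N0 hN] := finite_bound s rho.
pose M := expR (r * N).
have M0 : 0 < M := expR_gt0 _.
(* With this tolerance the cutoff error, weighted by [eta M], is at most 1 although [M] depends on
   [s]. *)
have dlt0 : 0 < (eta * M)^-1 by rewrite invr_gt0 mulr_gt0.
have [chi [Cchi chi01 chis hchi]] := cut s _ dlt0.
have [t tP] := Cc_covers Cchi.
have ut : uniq t by case: tP.
(* Truncation at [N] bounds [g^2] by [M] and changes nothing on [s], where [rho <= N]. *)
pose L x := r / 2 * Num.min (rho x) N.
pose g x := if x \in k then 0 else expR (L x).
pose phi x := g x * chi x.
have g0 x : 0 <= g x by rewrite /g; case: ifP; rewrite ?expR_ge0.
have sqL x : expR (L x) ^+ 2 = expR (r * Num.min (rho x) N).
  by rewrite -expRM_natl /L; congr expR; field.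
have gM x : g x ^+ 2 <= M.
  rewrite /g; case: ifP => _; first by rewrite expr0n ltW.
  by rewrite sqL ler_expR ler_pM2l// ge_min lexx orbT.
have gle x z : rho x <= z -> g x ^+ 2 <= expR (r * z).
  move=> xz; rewrite /g; case: ifP => _; first by rewrite expr0n expR_ge0.
  by rewrite sqL ler_expR ler_pM2l// ge_min xz.
have sphi : covers t phi.
  by apply: covers_sub tP _ => x; rewrite /phi => ->; rewrite mulr0.
have phiK x : K x -> phi x = 0.
  by rewrite kE /phi /g /= => ->; rewrite mul0r.
have := form_ge_caccioppoli hge sphi phiK uH.
set D := \sum_(_ <- _) _ * _ => caccio.
(* Error from the jump of [g] to 0 on [K]. It lives on the finite [hull k]; the [+ 1] accounts for a
   neighbour one step further out. *)
pose T x := if x \in hull k then expR (r * (rho x + 1)) else 0.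
have T0 x : 0 <= T x by rewrite /T; case: ifP; rewrite ?expR_ge0.
have bg x y : b x y * (g x - g y) ^+ 2 <= b x y * (2 * (c * g x ^+ 2 + T x)).
  have := b0 x y; rewrite le_eqVlt => /predU1P[<-|bxy]; first by rewrite !mul0r.
  rewrite ler_pM2l//.
  have rxy : rho y <= rho x + 1 by exact: rho1.
  have ryx : rho x <= rho y + 1 by apply: rho1; rewrite bC.
  have [xk|xk] := boolP (x \in hull k).
    have h1 : g x ^+ 2 <= T x by rewrite /T xk gle// lerDl.
    have h2 : g y ^+ 2 <= T x by rewrite /T xk gle.
    have := g0 x; have := g0 y; have := T0 x.
    have : 0 <= c * g x ^+ 2 by rewrite mulr_ge0 ?sqr_ge0// ltW.
    by nra.
  have xk' : x \notin k by apply: contra xk; exact: sub_hull.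
  have yk : y \notin k.
    apply: contra xk => yk; apply: (nb_hull yk); apply/negPn/negP => /nbP.
    by rewrite bC => /eqP; rewrite gt_eqF.
  rewrite /T (negbTE xk) addr0 /g (negbTE xk') (negbTE yk) mulrA.
  apply: expR_sub_sq_le; first exact: ltW.
  rewrite /L -mulrBr normrM ger0_norm; last by rewrite divr_ge0// ltW.
  rewrite ler_piMr ?divr_ge0 ?(ltW r0)//.
  by rewrite ler_norml /Order.min; do 2!case: ltP => ?; lra.
have grad x : 2^-1 * (\sum_(y <- t) b x y * (phi x - phi y) ^+ 2) <=
    (1 + eps) * (chi x ^+ 2 * (c * g x ^+ 2 + T x) * deg m b q x) +
    eta * M * (gradsq m b chi x * m x).
  rewrite (gradsq_seq _ tP).
  apply: (@le_trans _ _ (2^-1 * ((1 + eps) * chi x ^+ 2 *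
      (2 * (c * g x ^+ 2 + T x)) * (\sum_(y <- t) b x y) +
      eta * M * \sum_(y <- t) b x y * (chi x - chi y) ^+ 2))).
    rewrite ler_pM2l// !mulr_sumr -big_split/=; apply: ler_sum => y _.
    have bgxy := bg x y.
    apply: (@le_trans _ _ ((1 + eps) * chi x ^+ 2 * (b x y * (g x - g y) ^+ 2)
        + eta * g y ^+ 2 * (b x y * (chi x - chi y) ^+ 2))).
      (* Young's inequality for [phi x - phi y = chi x (g x - g y) + g y (chi x - chi y)]. *)
      rewrite -subr_ge0 [leRHS](_ : _ = b x y * (eps^-1 * (eps * (chi x * (g x - g y))
          - g y * (chi x - chi y)) ^+ 2)).
        by rewrite mulr_ge0// mulr_ge0 ?sqr_ge0// invr_ge0 ltW.
      by rewrite /phi /eta; field; rewrite gt_eqF.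
    apply: lerD.
      rewrite -[leRHS]mulrA (mulrC _ (b x y)) ler_wpM2l// mulr_ge0 ?sqr_ge0//.
      by rewrite addr_ge0// ltW.
    rewrite ler_wpM2r 1?mulr_ge0 ?sqr_ge0//.
    by rewrite ler_wpM2l ?gM// ltW.
  rewrite mulrDr; apply: lerD; last by rewrite mulrCA.
  rewrite (_ : 2^-1 * _ = (1 + eps) * (chi x ^+ 2 * (c * g x ^+ 2 + T x) *
    \sum_(y <- t) b x y)); last by field.
  rewrite ler_wpM2l ?addr_ge0 ?(ltW eps0)// ler_wpM2l//.
    by rewrite mulr_ge0 ?sqr_ge0// addr_ge0// mulr_ge0 ?sqr_ge0// ltW.
  exact: le_trans (sum_b_le _ ut) (rsum_b_le_deg _).
have {}caccio : a * D <= (1 + eps) * c * D + (1 + eps) * CT + 1.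
  apply: (le_trans caccio).
  apply: (@le_trans _ _ (\sum_(x <- t) ((1 + eps) * c * (deg m b q x * (u x * phi x) ^+ 2)
     + (1 + eps) * (u x ^+ 2 * T x * deg m b q x)
     + eta * M * (u x ^+ 2 * (gradsq m b chi x * m x))))).
    rewrite mulr_sumr; apply: ler_sum => x _.
    rewrite (eq_bigr (fun y => u x ^+ 2 * (b x y * (phi x - phi y) ^+ 2))); last first.
      by move=> y _; ring.
    rewrite -mulr_sumr mulrCA.
    apply: (le_trans (ler_wpM2l (sqr_ge0 _) (grad x))).
    rewrite mulrDr; apply: lerD; last by rewrite mulrCA.
    rewrite -subr_ge0 [leRHS](_ : _ = (1 + eps) * (u x ^+ 2 * T x * deg m b q x) *
      (1 - chi x ^+ 2)); last by rewrite /phi; ring.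
    have /andP[x0 x1] := chi01 x.
    rewrite mulr_ge0 ?subr_ge0 ?expr_le1//.
    by rewrite mulr_ge0 ?addr_ge0 ?(ltW eps0)// mulr_ge0// mulr_ge0 ?sqr_ge0.
  rewrite !big_split/= -!mulr_sumr; apply: lerD; first apply: lerD => //.
    rewrite ler_wpM2l ?addr_ge0 ?(ltW eps0)//.
    apply: (@le_trans _ _ (\sum_(x <- hull k) u x ^+ 2 * T x * deg m b q x)).
      apply: ler_sum_uniq => //; first by move=> x; rewrite mulr_ge0// mulr_ge0 ?sqr_ge0.
        exact: hull_uniq.
      by move=> x xk; rewrite /T (negbTE xk) mulr0 mul0r.
    by apply: ler_sum_seq => x xk; rewrite /T xk /W mulrA.
  have := ler_wpM2l (ltW (mulr_gt0 eta0 M0)) (hchi t ut).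
  by rewrite divff// gt_eqF// mulr_gt0.
have hD : D <= ((1 + eps) * CT + 1) / ((a - c) / 2).
  rewrite ler_pdivlMr; last by lra.
  by move: caccio; rewrite epsc; lra.
have hsD : \sum_(x <- s) deg m b q x * (u x * phi x) ^+ 2 <= D.
  apply: ler_sum_uniq => //; first by move=> x; rewrite mulr_ge0 ?sqr_ge0.
  by move=> x xt; rewrite (covers0 sphi xt) mulr0 expr0n mulr0.
have hsV : \sum_(x <- s) (if x \in k then V x else 0) <= \sum_(x <- undup k) V x.
  apply: (@le_trans _ _ (\sum_(x <- undup k) (if x \in k then V x else 0))).
    apply: ler_sum_uniq => //; first by move=> x; case: ifP.
      exact: undup_uniq.
    by move=> x; rewrite mem_undup => /negbTE ->.
  by apply: ler_sum => x _; case: ifP.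
apply: (@le_trans _ _ (4 * \sum_(x <- s) deg m b q x * (u x * phi x) ^+ 2 +
  \sum_(x <- s) (if x \in k then V x else 0))); last by lra.
rewrite mulr_sumr -big_split/=; apply: ler_sum_seq => x xs; rewrite -/(V x).
rewrite /phi /g; case: ifP => xk.
  by rewrite mul0r mulr0 expr0n mulr0 mulr0 add0r.
rewrite addr0 2!exprMn sqL /V min_l; last exact: hN.
rewrite -subr_ge0 [leRHS](_ : _ = V x * (4 * chi x ^+ 2 - 1)); last by rewrite /V; ring.
rewrite mulr_ge0// subr_ge0; have := chis x xs; nra.
Qed.

End Graph.

(** * Neighbour lists and the conclusion *)

Lemma locally_finite_nb (R : realType) (X : countType) (b : X -> X -> R) :
  is_graph b -> locally_finite_graph b ->
  exists nb : X -> seq X, forall x y, y \notin nb x -> b x y = 0.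
Proof.
move=> bG lf.
have h x : exists s : seq X, forall y, y \notin s -> b x y = 0.
  have /finite_seqP[s sE] := lf x; exists s => y; apply: contraNeq => bxy.
  have : [set y | adj b x y] y by rewrite /= /adj lt0r bxy graph_ge0.
  by rewrite sE.
by have [nb nbP] := choice h; exists nb.
Qed.

(** [decay r] quantifies over all graphs and functions, so that [r] depends on [a] alone. *)
Theorem theorem4p5 (R : realType) (a : R) (ha0 : 0 < a) (ha1 : a <= 1) :
  let decay (r : R) : Prop :=
    forall (X : countType) (m : X -> R) (b : X -> X -> R) (q : X -> R)
      (lam : R) (K : set X) (u : X -> R) (o : X),
      infinite_set [set: X] ->
      (forall x, 0 < m x) ->
      is_graph b ->
      locally_finite_graph b ->
      connected_graph b ->
      form_bounded_below m b q ->
      finite_set K ->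
      form_ge m b q lam (fun x => a * degm m b q x) (~` K) ->
      ((approximable m b u /\
          ((forall x, ~ K x -> formalH m b q u x - lam * u x = 0) \/
           (forall x, ~ K x -> 0 <= u x /\ formalH m b q u x - lam * u x <= 0)))
       \/
       [/\ class_V m b q, op_dom m b q u &
           forall x, ~ K x -> formalH m b q u x - lam * u x = 0]) ->
      inl2 (fun x => expR (r * dist b o x) * deg m b q x) u in
  [/\ exists r : R, 0 < r /\ decay r,
      forall r : R, 0 < r -> r ^+ 2 * ((1 + expR r) / 16) < a -> decay r &
      let r := 2 * a * expR (- a) in
      0 < r /\ r ^+ 2 * ((1 + expR r) / 16) < a].
Proof.
move=> decay.
have rP : let r := 2 * a * expR (- a) in
    0 < r /\ r ^+ 2 * ((1 + expR r) / 16) < a.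
  move=> r; have e0 := expR_gt0 (- a).
  (* Equivalently [r <= 2 a / (1 + a)], which is at most 1 for [a <= 1]. *)
  have ea : expR (- a) * (1 + a) <= 1.
    by rewrite -[leRHS](expRxMexpNx_1 a) mulrC ler_wpM2r ?expR_ge1Dx// ltW.
  have r0 : 0 < r by rewrite /r !mulr_gt0.
  have r1 : r <= 1 by rewrite /r; nra.
  (* As [e^(-1/2) >= 1/2], the square root of [e] is at most 2. Hence [(1 + e^r) / 16 <= 5/16], and
     [r^2 <= a] suffices. *)
  have er : expR r <= 4.
    have h1 := expR_ge1Dx (- 2^-1 : R).
    have h2 := expRxMexpNx_1 (2^-1 : R).
    have h3 := expR_gt0 (2^-1 : R).
    have h4 : expR (2^-1 : R) <= 2 by nra.
    have -> : expR r = expR (r / 2) ^+ 2 by rewrite -expRM_natl; congr expR; field.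
    have h5 : expR (r / 2) <= expR 2^-1 by rewrite ler_expR; lra.
    have h6 := expR_gt0 (r / 2).
    by nra.
  split=> //.
  have ra : r ^+ 2 <= a.
    have h1 : (r * (1 + a)) ^+ 2 <= (2 * a) ^+ 2.
      rewrite ler_sqr ?nnegrE; [|nra|nra].
      by rewrite /r -mulrA ler_piMr//; lra.
    have h2 : 4 * a * r ^+ 2 <= (r * (1 + a)) ^+ 2.
      rewrite -subr_ge0 [leRHS](_ : _ = (r * (1 - a)) ^+ 2); last by ring.
      exact: sqr_ge0.
    rewrite -(@ler_pM2l _ (4 * a)); last by lra.
    by apply: (le_trans h2); apply: (le_trans h1); lra.
  have er0 := expR_gt0 r.
  by nra.
have dec r : 0 < r -> r ^+ 2 * ((1 + expR r) / 16) < a -> decay r.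
  move=> r0 ra X m b q lam K u o _ m0 bG lf conn hbd finK hge hu.
  have [nb nbP] := locally_finite_nb bG lf.
  (* Both cases reduce to cutoffs and a sign condition off [K]. *)
  have [cut uH] : has_cutoffs m b u /\
      (forall x, ~ K x -> (formalH m b q u x - lam * u x) * u x <= 0).
    case: hu => [[app uH]|[_ [hu _] uH]].
      split; first exact: approximable_cutoffs.
      by case: uH => uH x /uH; [move=> ->; rewrite mul0r|
        move=> [u0 Hu]; rewrite mulr_le0_ge0].
    split; last by move=> x /uH ->; rewrite mul0r.
    have [B hB] := form_dom_deg m0 bG nbP ha0 finK hbd hge hu.
    exact: (@deg_cutoffs _ _ _ _ _ _ m0 bG nbP u B hB).
  have [B hB] := exp_decay m0 bG nbP r0 ra finK hge uH cut
    (dist_ge0 o conn) (fun x y => @dist_adj _ _ b o conn x y).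
  exact: le_lt_trans (esum_ub hB) (ltry _).
split=> //; exists (2 * a * expR (- a)).
by have [r0 ra] := rP; split=> //; exact: dec.
Qed.
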